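(* Consider the random field Ising model with bimodal field in dimension $d\ge1$. There is a constant $C_4\in(0,\infty)$, depending only on $d$, such that for every $0\le\beta<\infty$ there exists $H_2(\beta)>0$ such that for each $H>H_2(\beta)$, all finite subsets $\Delta\subseteq\Lambda$ of $\mathbb{Z}^d$, and every realization $\vec h\in\{-1,+1\}^\Lambda$, $$\sup_{\eta,\eta'\in\{-1,+1\}^{\partial_{ex}\Lambda}}TV\left(P^{\vec h}_{\Lambda,\eta,\beta,H}(\sigma_\Delta\in\cdot),P^{\vec h}_{\Lambda,\eta',\beta,H}(\sigma_\Delta\in\cdot)\right)\le\sum_{x\in\partial_{ex}\Delta,\,y\in\partial_{ex}\Lambda}e^{-C_4|x-y|}.$$
   Context: For a finite $\Lambda\subseteq\mathbb{Z}^d$, $\partial_{ex}\Lambda$ is the set of vertices of $\mathbb{Z}^d\setminus\Lambda$ having a nearest neighbor in $\Lambda$. For $\beta\ge0$, $H\ge 0$, $\eta\in\{-1,+1\}^{\partial_{ex}\Lambda}$ and $\vec h\in\mathbb{R}^\Lambda$, $P^{\vec h}_{\Lambda,\eta,\beta,H}$ is the probability measure on $\{-1,+1\}^\Lambda$ given by $$P^{\vec h}_{\Lambda,\eta,\beta,H}(\sigma)\propto\exp\Big[\beta\sum_{\{u,v\}}\sigma_u\sigma_v+\beta\sum_{\{u,v\}:u\in\Lambda,v\in\partial_{ex}\Lambda}\sigma_u\eta_v+H\sum_{u\in\Lambda}h_u\sigma_u\Big],$$ where the first sum is over (unordered) nearest neighbor pairs in $\Lambda$ and the second over nearest neighbor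 pairs. In the random field Ising model (RFIM), $\vec h$ is a realization of i.i.d. random variables $H_u$ of mean $0$ and variance $1$; the bimodal field has $\mathrm{Prob}(H_u=+1)=\mathrm{Prob}(H_u=-1)=1/2$, so $\vec h$ takes values in $\{-1,+1\}^\Lambda$. $\sigma_\Delta$ is the restriction of $\sigma$ to $\Delta$, $TV$ is total variation distance, $|\cdot|$ is the Euclidean norm. *)

(* Defs.v *)
From HB Require Import structures.
From mathcomp Require Import all_boot all_order all_algebra finmap.
From mathcomp Require Import classical_sets reals sequences exp.

Set Implicit Arguments.
Unset Strict Implicit.
Unset Printing Implicit Defensive.

Import Order.TTheory GRing.Theory Num.Theory.
Local Open Scope ring_scope.

Notation lattice d := 'rV[int]_d.

Definition nn (d : nat) (u v : lattice d) : bool :=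
  \sum_(i < d) `|u 0 i - v 0 i| == 1.

Definition enorm (R : realType) (d : nat) (x : lattice d) : R :=
  Num.sqrt (\sum_(i < d) (x 0 i)%:~R ^+ 2).

(* The candidates u ± e_i exhaust the neighbors of u, see in_extbd below. *)
Definition extbd (d : nat) (L : {fset lattice d}) : {fset lattice d} :=
  [fset v in [fset (u + (-1) ^+ nat_of_bool p.2 *: delta_mx 0 p.1)%R
               | u in L, p in {: 'I_d * bool}]
   | v \notin L]%fset.

Lemma nnP (d : nat) (u v : lattice d) :
  reflect (exists p : 'I_d * bool,
             v = u + (-1) ^+ nat_of_bool p.2 *: delta_mx 0 p.1)
          (nn u v).
Proof.
apply: (iffP eqP) => [suv|[[i b] /= ->]]; last first.
  rewrite (bigD1 i) //= big1 => [|j nji]; rewrite !mxE !eqxx /=.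
    by rewrite mulr1 opprD addrA subrr sub0r normrN normrX normrN1 expr1n addr0.
  by rewrite (negbTE nji) mulr0 addr0 subrr normr0.
have [i ui] : exists i, u 0 i - v 0 i != 0.
  apply/existsP; apply: contra_eqT suv; rewrite negb_exists => /forallP h.
  by rewrite big1 // => i _; move: (h i); rewrite negbK => /eqP->; rewrite normr0.
have ge1 : 1 <= `|u 0 i - v 0 i| by rewrite -gtz0_ge1 normr_gt0.
move: suv; rewrite (bigD1 i) //= => suv.
have s0 : \sum_(j < d | j != i) `|u 0 j - v 0 j| = 0.
  apply/eqP; rewrite eq_le sumr_ge0 ?andbT //.
  by rewrite -(lerD2l `|u 0 i - v 0 i|) suv addr0.
exists (i, 0 < u 0 i - v 0 i); apply/rowP => j; rewrite !mxE /=.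
have [->|nji] /= := eqVneq j i.
  rewrite mulr1; move: suv; rewrite s0 addr0; case: ltrP => [h|h].
    by rewrite gtr0_norm // expr1 => <-; rewrite opprB addrC subrK.
  by rewrite ler0_norm // expr0 => <-; rewrite opprB addrC subrK.
have /eqP := psumr_eq0P (fun k _ => normr_ge0 (u 0 k - v 0 k)) s0 nji.
by rewrite normr_eq0 subr_eq0 mulr0 addr0 => /eqP.
Qed.

Lemma in_extbd (d : nat) (L : {fset lattice d}) (v : lattice d) :
  (v \in extbd L) = (v \notin L) && [exists u : L, nn (val u) v].
Proof.
rewrite !inE /= andbC; congr (_ && _).
apply/imfset2P/existsP => [[u uL [p _ ->]]|[u /nnP[p ->]]].
  by exists [` uL]%fset; apply/nnP; exists p.
by exists (val u); [exact: valP|exists p].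
Qed.

(* Configurations in {-1,+1}^S are encoded as boolean functions on S, with
   true standing for +1 and false for -1. *)
Notation config S := {ffun S -> bool}.

Definition spin (R : realType) (b : bool) : R := if b then 1 else -1.

(* Unordered nearest neighbor pairs {u,v} contained in L. *)
Definition edges (d : nat) (L : {fset lattice d}) : {set {set L}} :=
  [set e : {set L} | [exists u, exists v,
     nn (val u) (val v) && (e == [set u; v])]]%SET.

Section RFIM.
Variables (R : realType) (d : nat) (L : {fset lattice d}).
Variables (beta H : R) (h : {ffun L -> R}) (eta : config (extbd L)).

(* As nn is irreflexive, the product over u in an edge {u,v} is s_u * s_v. *)
Definition log_weight (s : config L) : R :=
  beta * (\sum_(e in edges L) \prod_(u in e) spin R (s u))
  + beta * (\sum_(u : L) \sum_(v : extbd L | nn (val u) (val v))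
              spin R (s u) * spin R (eta v))
  + H * (\sum_(u : L) h u * spin R (s u)).

Definition partition_function : R := \sum_(s : config L) expR (log_weight s).

Definition gibbs_mass (s : config L) : R :=
  expR (log_weight s) / partition_function.

Definition gibbs (A : {set config L}) : R := \sum_(s in A) gibbs_mass s.

Lemma gibbs_mass_ge0 s : 0 <= gibbs_mass s.
Proof. by rewrite divr_ge0 ?expR_ge0 // sumr_ge0 // => t _; exact: expR_ge0. Qed.

Lemma gibbsT : gibbs [set: config L]%SET = 1.
Proof.
rewrite /gibbs (eq_bigl xpredT) => [|s]; last by rewrite inE.
rewrite -mulr_suml mulfV // gt_eqF // /partition_function.
rewrite (bigD1 [ffun=> true]) //= ltr_pwDl ?expR_gt0 //.
by rewrite sumr_ge0 // => t _; exact: expR_ge0.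
Qed.

End RFIM.

Definition restr (d : nat) (D L : {fset lattice d}) (sDL : (D `<=` L)%fset)
  (s : config L) : config D := [ffun x : D => s (fincl sDL x)].

(* The law of the restriction to D under P. *)
Definition marginal (R : realType) (d : nat) (D L : {fset lattice d})
    (sDL : (D `<=` L)%fset) (P : {set config L} -> R)
    (A : {set config D}) : R :=
  P [set s | restr sDL s \in A]%SET.

Definition TV (R : realType) (T : finType) (P Q : {set T} -> R) : R :=
  sup (range (fun A : {set T} => `|P A - Q A|)).

(* Main.v *)
(* Couple the two Gibbs measures independently and look at the cluster of sites
   where the two samples disagree and that is linked to the boundary of L by such
   sites. Exchanging the two samples off this cluster preserves the product
   measure, because every site next to the cluster carries equal spins; hence the
   laws on D differ by at most the probability that the cluster meets D. A site
   where the samples disagree carries, in one of them, the spin opposed to the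
   field, and flipping it back gains a factor exp(2H - 8 d beta), so n prescribed
   sites all disagree with probability at most (2 exp(8 d beta - 2H))^n. A link
   from x to y contains a self-avoiding path with exactly |x-y|_1 sites, and for
   large H the (2d)^(|x-y|_1 - 1) candidate paths are outweighed; since H may
   depend on d, the constant C4 = 1 is reached. *)
Require Import Defs.
From HB Require Import structures.
From mathcomp Require Import all_boot all_order all_algebra finmap.
From mathcomp Require Import classical_sets reals sequences exp.
From mathcomp Require Import lra.

Set Implicit Arguments.
Unset Strict Implicit.
Unset Printing Implicit Defensive.

Import Order.TTheory GRing.Theory Num.Theory.
Local Open Scope ring_scope.

(** * Distances and nearest neighbors on the lattice *)

Definition l1dist (d : nat) (u v : lattice d) : int := \sum_(i < d) `|u 0 i - v 0 i|.

Lemma l1dist_ge0 d (u v : lattice d) : 0 <= l1dist u v.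
Proof. exact: sumr_ge0. Qed.

Lemma l1dist_triangle d (u v w : lattice d) :
  l1dist u w <= l1dist u v + l1dist v w.
Proof.
rewrite -big_split; apply: ler_sum => i _ /=.
by rewrite -[u 0 i](subrK (v 0 i)) -addrA (le_trans (ler_normD _ _)) // subrK.
Qed.

Lemma l1dist_eq0 d (u v : lattice d) : l1dist u v = 0 -> u = v.
Proof.
move=> /psumr_eq0P uv; apply/rowP => i; apply/eqP.
by rewrite -subr_eq0 -normr_eq0 uv.
Qed.

Lemma enorm_le_l1 (R : realType) d (u v : lattice d) :
  enorm R (u - v) <= (l1dist u v)%:~R.
Proof.
have l1R : (l1dist u v)%:~R = \sum_(i < d) `|((u - v) 0 i)%:~R : R|.
  by rewrite rmorph_sum; apply: eq_bigr => i _; rewrite !mxE /= intr_norm.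
rewrite -[leRHS]ger0_norm ?ler0z ?l1dist_ge0 // -sqrtr_sqr ler_wsqrtr // l1R.
suff [] : 0 <= \sum_(i < d) `|((u - v) 0 i)%:~R : R| /\
  \sum_(i < d) ((u - v) 0 i)%:~R ^+ 2 <=
    (\sum_(i < d) `|((u - v) 0 i)%:~R : R|) ^+ 2 by [].
elim/big_ind2: _ => [||i _]; first by rewrite expr0n.
  move=> a1 b1 a2 b2 [a1_ge0 ba1] [a2_ge0 ba2]; split; first exact: addr_ge0.
  by rewrite sqrrD; have := mulr_ge0 a1_ge0 a2_ge0; lra.
by rewrite normr_ge0 real_normK // num_real.
Qed.

Lemma nn_sym d (u v : lattice d) : nn u v = nn v u.
Proof. by rewrite /nn; under eq_bigr do rewrite distrC. Qed.

Lemma nn_irr d (u : lattice d) : nn u u = false.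
Proof. by rewrite /nn big1 // => i _; rewrite subrr normr0. Qed.

(** The injection [f] lets one count, that of the signed unit vectors, serve both the sites of [L]
    and the vertices of [extbd L]. *)
Lemma card_nn d (T : finType) (f : T -> lattice d) (u : lattice d) :
  injective f -> (#|[pred v | nn u (f v)]| <= d * 2)%N.
Proof.
move=> f_inj.
pose s := [seq u + (-1) ^+ nat_of_bool p.2 *: delta_mx 0 p.1 | p : 'I_d * bool].
have -> : (d * 2)%N = size s by rewrite size_map -cardE card_prod card_ord card_bool.
rewrite cardE -(size_map f); apply: uniq_leq_size => [|w /mapP[v]].
  by rewrite map_inj_uniq ?enum_uniq.
rewrite mem_enum => /nnP[p fv] ->; rewrite fv; apply/mapP.
by exists p; rewrite ?mem_enum.
Qed.

(** * Clusters linked to the boundary, and paths inside them *)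

Section Lattice.
Variables (d : nat) (L : {fset lattice d}).
Implicit Types (A : {set L}) (x u v : L).

Lemma edgeP (e : {set L}) : e \in edges L ->
  exists u v, [/\ nn (val u) (val v), u != v & e = [set u; v]%SET].
Proof.
rewrite inE => /existsP[u /existsP[v /andP[uv /eqP->]]]; exists u, v; split=> //.
by apply: contraTneq uv => ->; rewrite nn_irr.
Qed.

Lemma card_edges u : (#|[set e in edges L | u \in e]%SET| <= d * 2)%N.
Proof.
apply: leq_trans (card_nn (f := val : L -> _) (val u) val_inj).
apply: leq_trans (leq_imset_card (fun v => [set u; v]%SET) _).
apply/subset_leq_card/fintype.subsetP => e; rewrite inE => /andP[/edgeP[v [w [vw _ ->]]]].
rewrite !inE => /orP[]/eqP->; apply/imsetP; first by exists w; rewrite ?inE.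
by exists v; rewrite ?inE 1?nn_sym // finset.setUC.
Qed.

Definition adj A u v := [&& nn (val u) (val v), u \in A & v \in A].

Definition link A x (y : lattice d) :=
  (x \in A) && [exists v, nn (val v) y && connect (adj A) x v].

(** This is the union of the connected components of [A] that touch the exterior boundary of [L]. *)
Definition bd_cluster A : {set L} :=
  [set x | [exists y : extbd L, link A x (val y)]]%SET.

Lemma bd_cluster_sub A : bd_cluster A \subset A.
Proof. by apply/fintype.subsetP => u; rewrite inE => /existsP[y /andP[]]. Qed.

(** If [v] were in [A], prepending it to the link of [u] would put it in the cluster. *)
Lemma bd_cluster_adj A u v : nn (val u) (val v) ->
  u \in bd_cluster A -> v \notin bd_cluster A -> v \notin A.
Proof.
move=> uv uC; apply: contra => vA; have uA := fintype.subsetP (bd_cluster_sub A) _ uC.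
move: uC; rewrite !inE => /existsP[y /andP[_ /existsP[w /andP[wy uw]]]].
apply/existsP; exists y; rewrite /link vA; apply/existsP; exists w.
by rewrite wy (connect_trans _ uw) // connect1 // /adj nn_sym uv vA.
Qed.

(** A site of [A] next to the boundary is linked to it by the trivial path. *)
Lemma bd_cluster_bd A u (y : extbd L) : nn (val u) (val y) ->
  u \notin bd_cluster A -> u \notin A.
Proof.
move=> uy; apply: contra => uA; rewrite inE; apply/existsP; exists y.
by rewrite /link uA; apply/existsP; exists u; rewrite uy connect0.
Qed.

Lemma link_path A x y : link A x y ->
  exists p, [/\ path (adj A) x p, uniq (x :: p), all (mem A) (x :: p)
                & nn (val (last x p)) y].
Proof.
case/andP=> xA /existsP[v /andP[vy /connectP[p0 xp0 def_v]]].
case/shortenP: xp0 def_v => p xp p_uniq _ def_v; exists p; rewrite -def_v.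
split=> //=; rewrite xA /=; elim: p x xp {def_v p_uniq xA} => //= w p IH x.
by case/andP=> /and3P[_ _ ->]; exact: IH.
Qed.

(** Each step of [p], and the final one to [y], covers distance exactly 1. *)
Lemma path_l1dist A x p y : path (adj A) x p -> nn (val (last x p)) y ->
  l1dist (val x) y <= (size p).+1%:Z.
Proof.
elim: p x => [|w p IH] x /=; first by move=> _ /eqP xy; rewrite /l1dist xy.
case/andP=> /and3P[/eqP xw _ _] /IH/[apply] wy.
by rewrite (le_trans (l1dist_triangle _ (val w) _)) // /l1dist xw intS lerD2l.
Qed.

(* Following the link from a point of D to the boundary of L, either some first
   vertex lies outside of D, or D itself touches the boundary at y. *)
Lemma bd_cluster_exit A (D : {fset lattice d}) u :
  (D `<=` L)%fset -> val u \in D -> u \in bd_cluster A ->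
  exists (x : lattice d) (y : extbd L), x \in extbd D /\
    (x = val y \/ exists2 v : L, x = val v & link A v (val y)).
Proof.
move=> sDL uD; rewrite inE => /existsP[y /link_path[p [up _ _]]].
have yL : val y \notin L by have := valP y; rewrite in_extbd => /andP[].
elim: p u uD up => [|w p IH] u uD /= => [_ uy|/andP[/and3P[uw _ wA] wp] ly].
  exists (val y), y; split; last by left.
  rewrite in_extbd (contra (fsubsetP sDL _) yL).
  by apply/existsP; exists [` uD]%fset.
have [wD|wD] := boolP (val w \in D); first exact: IH wp ly.
exists (val w), y; split.
  by rewrite in_extbd wD; apply/existsP; exists [` uD]%fset.
right; exists w; rewrite // /link wA; apply/existsP; exists (last w p).
by rewrite ly; apply/connectP; exists p.
Qed.

(** Walks may revisit sites, which keeps the count a plain product; self-avoidance is tested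
    separately. The starting point is not listed. *)
Fixpoint nn_paths n x : seq (seq L) :=
  if n is n.+1 then
    flatten [seq [seq v :: p | p <- nn_paths n v] | v <- enum [pred v | nn (val x) (val v)]]
  else [:: [::]].

Lemma size_nn_paths n x : (size (nn_paths n x) <= (d * 2) ^ n)%N.
Proof.
elim: n x => //= n IH x; rewrite size_flatten /shape -map_comp.
have := card_nn (f := val : L -> _) (val x) val_inj.
rewrite cardE expnS => nb; apply: leq_trans (leq_mul nb (leqnn _)).
elim: (enum _) => //= v s IHs; rewrite mulSn leq_add ?size_map //.
Qed.

Lemma mem_nn_paths A x p : path (adj A) x p -> p \in nn_paths (size p) x.
Proof.
elim: p x => //= v p IH x /andP[/and3P[xv _ _] vp].
apply/flattenP; exists [seq v :: q | q <- nn_paths (size p) v]; last by rewrite map_f ?IH.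
by apply/mapP; exists v; rewrite // mem_enum inE.
Qed.

End Lattice.

(** * Exchanging two independent samples off the cluster *)

Section Swap.
Variables (R : realType) (d : nat) (L : {fset lattice d}).
Variables (beta H : R) (h : {ffun L -> R}).
Implicit Types (C : {set L}) (s : config L) (q : config L * config L).
Implicit Types (eta : config (extbd L)).

Definition disagreement q : {set L} := [set u | q.1 u != q.2 u]%SET.

Definition splice C s s' : config L := [ffun u => if u \in C then s u else s' u].

(** A pair leaving [C] ends at a site where [s] and [s'] agree, so on every edge each splice
    coincides with one of the two originals. A site off [C] next to the boundary has equal spins, so
    exchanging them is invisible to [eta] and [eta']. *)
Lemma log_weight_splice C eta eta' s s' :
  (forall u v : L, nn (val u) (val v) -> u \in C -> v \notin C -> s v = s' v) ->
  (forall (u : L) (y : extbd L), nn (val u) (val y) -> u \notin C -> s u = s' u) ->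
  log_weight beta H h eta (splice C s s') + log_weight beta H h eta' (splice C s' s)
  = log_weight beta H h eta s + log_weight beta H h eta' s'.
Proof.
move=> inC bdC; rewrite /log_weight addrACA [X in X + _ = _]addrACA.
rewrite [RHS]addrACA [X in _ = X + _]addrACA.
rewrite -!mulrDr -!big_split /=; congr (_ * (_ + _) + _ * _).
- apply: eq_bigr => e /edgeP[u [v [uv nuv ->]]].
  rewrite !big_setU1 ?inE //= !big_set1 !ffunE.
  have := inC u v uv; have := inC v u; rewrite nn_sym => /(_ uv).
  case: (u \in C); case: (v \in C) => // svu suv; last exact: addrC.
    by rewrite suv.
  by rewrite svu.
- apply: eq_bigr => u _; rewrite -!big_split; apply: eq_bigr => y uy /=.
  rewrite !ffunE; have := bdC u y uy.
  by case: (_ \in C) => // ->.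
- apply: eq_bigr => u _; rewrite !ffunE.
  by case: (_ \in C) => //; rewrite addrC.
Qed.

Definition swap q := let C := bd_cluster (disagreement q) in
  (splice C q.1 q.2, splice C q.2 q.1).

(** Hence [swap] leaves the cluster itself unchanged, which makes it an involution. *)
Lemma disagreement_swap q : disagreement (swap q) = disagreement q.
Proof.
by apply/setP => u; rewrite !inE !ffunE; case: (u \in _) => //; rewrite eq_sym.
Qed.

Lemma swapK : involutive swap.
Proof.
move=> q; rewrite {1}/swap disagreement_swap [RHS]surjective_pairing.
by congr pair; apply/ffunP => u; rewrite !ffunE; case: (u \in _).
Qed.

Definition joint_mass eta eta' q :=
  gibbs_mass beta H h eta q.1 * gibbs_mass beta H h eta' q.2.

Lemma joint_mass_ge0 eta eta' q : 0 <= joint_mass eta eta' q.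
Proof. by rewrite mulr_ge0 ?gibbs_mass_ge0. Qed.

Lemma joint_mass_swap eta eta' q : joint_mass eta eta' (swap q) = joint_mass eta eta' q.
Proof.
rewrite /joint_mass /gibbs_mass !mulf_div -!expRD log_weight_splice // => u v uv.
  by move=> uC /(bd_cluster_adj uv uC); rewrite inE negbK => /eqP.
by move=> /(bd_cluster_bd uv); rewrite inE negbK => /eqP.
Qed.

Lemma sum_gibbs_mass eta : \sum_s gibbs_mass beta H h eta s = 1.
Proof. by rewrite -[RHS](gibbsT beta H h eta); apply: eq_bigl => s; rewrite inE. Qed.

(** Both probabilities become sums over the product measure; only pairs whose cluster meets [D]
    survive the cancellation. *)
Lemma gibbs_sub_le (D : {set L}) eta eta' (E : {set config L}) :
  (forall s s', {in D, s =1 s'} -> (s \in E) = (s' \in E)) ->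
  `|gibbs beta H h eta E - gibbs beta H h eta' E| <=
  \sum_(q | ~~ [disjoint D & bd_cluster (disagreement q)]) joint_mass eta eta' q.
Proof.
move=> E_loc; pose m := joint_mass eta eta'.
have -> : gibbs beta H h eta E = \sum_q (q.1 \in E)%:R * m q.
  rewrite -(pair_bigA _ (fun s s' => (s \in E)%:R * m (s, s'))) /= /gibbs big_mkcond.
  apply: eq_bigr => s _; rewrite -mulr_sumr /m /joint_mass /= -mulr_sumr sum_gibbs_mass mulr1.
  by case: ifP; rewrite ?mul1r ?mul0r.
have -> : gibbs beta H h eta' E = \sum_q (q.2 \in E)%:R * m q.
  rewrite -(pair_bigA _ (fun s s' => (s' \in E)%:R * m (s, s'))) /= exchange_big.
  rewrite /gibbs big_mkcond; apply: eq_bigr => s _ /=.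
  rewrite -mulr_sumr /m /joint_mass /= -mulr_suml sum_gibbs_mass mul1r.
  by case: ifP; rewrite ?mul1r ?mul0r.
rewrite -sumrB; under eq_bigr do rewrite -mulrBl.
rewrite (bigID (fun q => [disjoint D & bd_cluster (disagreement q)])) /=.
under eq_bigr do rewrite mulrBl.
(* When the cluster misses [D], [swap] exchanges the two samples on all of [D], so it carries the
   first sum onto the second. *)
rewrite sumrB [X in X - _](reindex_inj (can_inj swapK)) /=.
rewrite [X in X - _](eq_big (fun q => [disjoint D & bd_cluster (disagreement q)])
  (fun q => (q.2 \in E)%:R * m q)); first last.
- move=> q; rewrite disagreement_swap /m joint_mass_swap => dq.
  congr (_%:R * _); congr nat_of_bool; apply: E_loc => u uD.
  by rewrite ffunE (disjointFr dq uD).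
- by move=> q; rewrite disagreement_swap.
rewrite subrr add0r (le_trans (ler_norm_sum _ _ _)) // ler_sum // => q _.
rewrite normrM (ger0_norm (joint_mass_ge0 _ _ _)) ler_piMl ?joint_mass_ge0 //.
by case: (_ \in E); case: (_ \in E); rewrite ?subrr ?subr0 ?sub0r ?normrN ?normr0 ?normr1.
Qed.

End Swap.

(** * The cost of disagreeing at prescribed sites *)

Section Flip.
Variables (R : realType) (d : nat) (L : {fset lattice d}).
Variables (beta H : R) (h : {ffun L -> R}).
Hypotheses (beta_ge0 : 0 <= beta) (h_pm1 : forall u : L, h u = -1 \/ h u = 1).
Implicit Types (s : config L) (u : L) (eta : config (extbd L)).

Let ground u : bool := h u == 1.

Definition flip u s : config L := [ffun v => (v == u) (+) s v].

Lemma flipK u : involutive (flip u).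
Proof. by move=> s; apply/ffunP => v; rewrite !ffunE addKb. Qed.

Lemma spin_norm b : `|spin R b| = 1.
Proof. by case: b; rewrite /= ?normrN normr1. Qed.

Definition flip_ratio : R := expR (8 * d%:R * beta - 2 * H).

(** At most 2d inner edges and at most 2d boundary pairs contain [u], and each changes by at most 2,
    whence 8d in all; aligning the spin with the field gains exactly 2H. *)
Lemma log_weight_flip eta u s : s u != ground u ->
  log_weight beta H h eta s <=
  log_weight beta H h eta (flip u s) + (8 * d%:R * beta - 2 * H).
Proof.
move=> su; rewrite /log_weight.
set e1 := \sum_(e in _) _; set b1 := \sum_u _; set h1 := \sum_u _.
set e2 := \sum_(e in _) _; set b2 := \sum_u _; set h2 := \sum_u _.
have ee : e1 - e2 <= 4 * d%:R.
  rewrite /e1 /e2 -sumrB (bigID (fun e : {set L} => u \in e)) /=.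
  rewrite [X in _ + X]big1 ?addr0 => [|e /andP[_ ue]]; last first.
    apply/eqP; rewrite subr_eq0; apply/eqP/eq_bigr => v ve; rewrite ffunE.
    by case: eqP ue => // <-; rewrite ve.
  have -> : 4 * d%:R = (d * 2)%:R * 2 :> R by rewrite natrM; lra.
  apply: (@le_trans _ _ (\sum_(e in edges L | u \in e) 2)).
    apply: ler_sum => e _; apply: le_trans (ler_norm _) _.
    apply: le_trans (ler_normB _ _) _; rewrite !normr_prod !big1 // => i _; exact: spin_norm.
  rewrite sumr_const -[leLHS]mulr_natl ler_pM2r ?ltr0n // ler_nat.
  apply: leq_trans (card_edges u); apply: subset_leq_card; apply/fintype.subsetP => e.
  by rewrite inE.
have bb : b1 - b2 <= 4 * d%:R.
  rewrite /b1 /b2 -sumrB (bigD1 u) //= [X in _ + X]big1 ?addr0 => [|v vu]; last first.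
    by rewrite -sumrB big1 // => y _; rewrite ffunE (negbTE vu) subrr.
  have -> : 4 * d%:R = (d * 2)%:R * 2 :> R by rewrite natrM; lra.
  rewrite -sumrB; apply: (@le_trans _ _ (\sum_(y : extbd L | nn (val u) (val y)) 2)).
    apply: ler_sum => y _; apply: le_trans (ler_norm _) _.
    by apply: le_trans (ler_normB _ _) _; rewrite !normrM !spin_norm mulr1.
  rewrite sumr_const -[leLHS]mulr_natl ler_pM2r ?ltr0n // ler_nat.
  exact: card_nn val_inj.
have hh : h1 - h2 = - 2.
  rewrite /h1 /h2 -sumrB (bigD1 u) //= [X in _ + X]big1 ?addr0 => [|v vu]; last first.
    by rewrite ffunE (negbTE vu) subrr.
  rewrite ffunE eqxx /=; move: su; rewrite /ground.
  case: (h_pm1 u) => ->; rewrite ?eqxx.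
    rewrite (_ : (-1 == 1 :> R) = false); last by apply/negbTE/eqP; lra.
    by case: (s u) => //= _; lra.
  by case: (s u) => //= _; lra.
have := ler_wpM2l beta_ge0 ee; have := ler_wpM2l beta_ge0 bb.
have -> : h1 = h2 - 2 by lra.
lra.
Qed.

(** Flipping at [u] injects the configurations opposing the field there into those of [P] that
    follow it. *)
Lemma sum_flip eta u (P : pred (config L)) : (forall s, P (flip u s) = P s) ->
  \sum_(s | P s && (s u != ground u)) gibbs_mass beta H h eta s
  <= flip_ratio * \sum_(s | P s) gibbs_mass beta H h eta s.
Proof.
move=> Pflip; rewrite mulr_sumr [leRHS](reindex_inj (can_inj (flipK u))) /=.
under [leRHS]eq_bigl do rewrite Pflip.
rewrite [leRHS](bigID (fun s => s u != ground u)) /= ler_wpDr //.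
  by rewrite sumr_ge0 // => s _; rewrite mulr_ge0 ?expR_ge0 ?gibbs_mass_ge0.
apply: ler_sum => s /andP[_ su]; rewrite /gibbs_mass mulrA ler_wpM2r //.
  by rewrite invr_ge0 sumr_ge0 // => t _; rewrite expR_ge0.
by rewrite -expRD ler_expR addrC log_weight_flip.
Qed.

(** Sites are removed one at a time. Flipping one sample at [u] does not affect the event at the
    other sites, since [r] has no repetition; the 2 counts which sample opposes the field. *)
Lemma disagreement_prob eta eta' (r : seq L) : uniq r ->
  \sum_(q | all (mem (disagreement q)) r) joint_mass beta H h eta eta' q
  <= (2 * flip_ratio) ^+ size r.
Proof.
elim: r => [_|u r IH /= /andP[ur /IH{}IH]].
  rewrite expr0 -(pair_bigA _ (fun s s' => joint_mass beta H h eta eta' (s, s'))) /=.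
  rewrite /joint_mass /=.
  by under eq_bigr do rewrite -mulr_sumr sum_gibbs_mass mulr1; rewrite sum_gibbs_mass.
rewrite exprS -mulrA; apply: le_trans (ler_wpM2l _ (ler_wpM2l (expR_ge0 _) IH)) => //.
pose P q := all (mem (disagreement q)) r.
have Pflip1 s s' : P (flip u s, s') = P (s, s').
  by apply: eq_in_all => v vr; rewrite /= !inE ffunE; case: (v =P u) vr ur => // -> ->.
have Pflip2 s s' : P (s, flip u s') = P (s, s').
  by apply: eq_in_all => v vr; rewrite /= !inE ffunE; case: (v =P u) vr ur => // -> ->.
pose m := joint_mass beta H h eta eta'.
have m_ge0 q : 0 <= m q by exact: joint_mass_ge0.
(* If the samples differ at [u], one of them differs from [ground u]. *)
apply: (@le_trans _ _ (\sum_(q | P q && (q.1 u != ground u)) m q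
                     + \sum_(q | P q && (q.2 u != ground u)) m q)).
  rewrite [X in X + _]big_mkcond [X in _ + X]big_mkcond -big_split big_mkcond /=.
  apply: ler_sum => q _; rewrite !inE andbC -/(P q); case: (P q) => /=; last by rewrite addr0.
  rewrite -[joint_mass _ _ _ _ _ q]/(m q); move: (m q) (m_ge0 q) => w w_ge0.
  by case: (q.1 u); case: (q.2 u); case: (ground u); rewrite /= ?addr0 ?add0r ?addr_ge0.
rewrite [leRHS]mulr_natl [leRHS]mulr2n; have pairE (Q : pred (config L * config L)) :
    \sum_(q | Q q) m q = \sum_s \sum_(s' | Q (s, s')) m (s, s').
  by rewrite pair_big_dep /=; apply: eq_big => [[]|[]].
apply: lerD.
  (* The sample being flipped is summed first, with the other one frozen. *)
  rewrite !pairE [leLHS](exchange_big_dep predT) //=.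
  rewrite [in leRHS](exchange_big_dep predT) //= mulr_sumr.
  apply: ler_sum => s' _.
  have factor (Q : pred (config L)) : \sum_(s | Q s) m (s, s') =
    (\sum_(s | Q s) gibbs_mass beta H h eta s) * gibbs_mass beta H h eta' s'.
    by rewrite mulr_suml.
  by rewrite !factor [leRHS]mulrA ler_wpM2r ?gibbs_mass_ge0 ?sum_flip.
rewrite !pairE mulr_sumr; apply: ler_sum => s _.
have factor (Q : pred (config L)) : \sum_(s' | Q s') m (s, s') =
  gibbs_mass beta H h eta s * \sum_(s' | Q s') gibbs_mass beta H h eta' s'.
  by rewrite mulr_sumr.
by rewrite !factor [leRHS]mulrCA ler_wpM2l ?gibbs_mass_ge0 ?sum_flip.
Qed.

End Flip.

(** * Summing over candidate paths *)

Lemma link_nn_path d (L : {fset lattice d}) (A : {set L}) (x : L) y n :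
  link A x y -> n.+1%:Z <= l1dist (val x) y ->
  exists2 p, p \in nn_paths n x & [&& size p == n, uniq (x :: p) & all (mem A) (x :: p)].
Proof.
case/link_path=> p [xp p_uniq pA py] n_lt.
have n_le : (n <= size p)%N.
  by rewrite -ltnS -lez_nat; exact: le_trans n_lt (path_l1dist xp py).
have st : size (take n p) = n by rewrite size_takel.
(* The first [n] steps visit n+1 distinct sites, all in [A]. *)
exists (take n p); rewrite ?st ?eqxx /=.
  by rewrite -{2}st (mem_nn_paths (A := A)) // take_path.
move: p_uniq pA; rewrite -{1 2}(cat_take_drop n p) /= cat_uniq all_cat mem_cat negb_or.
by case/andP=> /andP[-> _] /and3P[-> _ _] /and3P[-> -> _].
Qed.

Lemma link_prob (R : realType) d (L : {fset lattice d}) (beta H : R)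
    (h : {ffun L -> R}) (eta eta' : config (extbd L)) (x : L) (y : lattice d) :
  (0 < d)%N -> 0 <= beta -> (forall u : L, h u = -1 \/ h u = 1) ->
  (d * 2)%:R * (2 * flip_ratio d beta H) <= expR (- 1) -> y \notin L ->
  \sum_(q | link (disagreement q) x y) joint_mass beta H h eta eta' q
  <= expR (- enorm R (val x - y)).
Proof.
move=> d_gt0 beta_ge0 h_pm1 flip_ratio_small yL.
(* The predecessor is not truncated: [x] is in [L] and [y] is not, so their distance is positive. *)
pose n := `|l1dist (val x) y|.-1%N.
have l1E : l1dist (val x) y = n.+1.
  rewrite /n prednK ?gez0_abs ?l1dist_ge0 // absz_gt0.
  by apply: contraNneq yL => /l1dist_eq0 <-; exact: valP.
pose good (q : config L * config L) p :=
  [&& size p == n, uniq (x :: p) & all (mem (disagreement q)) (x :: p)].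
pose m := joint_mass beta H h eta eta'.
have delta_ge0 : 0 <= 2 * flip_ratio d beta H by rewrite mulr_ge0 ?expR_ge0.
apply: (@le_trans _ _ (\sum_(p <- nn_paths n x) \sum_(q | good q p) m q)).
  rewrite (exchange_big_dep predT) //= big_mkcond ler_sum // => q _.
  have m_ge0 : 0 <= m q by exact: joint_mass_ge0.
  case: ifP => [xy|_]; last by rewrite sumr_ge0.
  have [|p pn gp] := link_nn_path (n := n) xy; first by rewrite l1E.
  by rewrite (big_rem p pn) /= (gp : good q p) lerDl sumr_ge0.
apply: (@le_trans _ _ (\sum_(p <- nn_paths n x) (2 * flip_ratio d beta H) ^+ n.+1)).
  apply: ler_sum => p _; rewrite /good.
  have [sp|] := eqVneq (size p) n; last by rewrite big_pred0_eq exprn_ge0.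
  have [p_uniq|] := boolP (uniq (x :: p)); last by rewrite big_pred0_eq exprn_ge0.
  rewrite -sp; exact: disagreement_prob p_uniq.
rewrite big_const_seq count_predT iter_addr_0 -[leLHS]mulr_natl.
apply: (@le_trans _ _ (expR (- 1) ^+ n.+1)); last first.
  rewrite -expRM_natr ler_expR mulN1r lerN2.
  by rewrite (le_trans (enorm_le_l1 _ _ _)) // l1E.
apply: le_trans (lerXn2r n.+1 _ _ flip_ratio_small); rewrite ?nnegrE ?mulr_ge0 ?expR_ge0 //.
(* There are n steps but n+1 sites: the path count is raised to the power n+1, so that each site
   carries one factor 2d. *)
rewrite [leRHS]exprMn ler_wpM2r ?exprn_ge0 // -natrX ler_nat.
by rewrite (leq_trans (size_nn_paths _ _)) // leq_pexp2l // muln_gt0 d_gt0.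
Qed.

(** * Choice of the constants and union bound *)

Theorem theorem5 (R : realType) (d : nat) (d_ge1 : (1 <= d)%N) :
  exists2 C4 : R, 0 < C4 &
  forall beta : R, 0 <= beta ->
  exists2 H2 : R, 0 < H2 &
  forall H : R, H2 < H ->
  forall (D L : {fset lattice d}) (sDL : (D `<=` L)%fset)
    (h : {ffun L -> R}), (forall u : L, h u = -1 \/ h u = 1) ->
  sup (range (fun p : config (extbd L) * config (extbd L) =>
    TV (marginal sDL (gibbs beta H h p.1))
       (marginal sDL (gibbs beta H h p.2))))
  <= \sum_(x <- extbd D) \sum_(y <- extbd L) expR (- (C4 * enorm R (x - y))).
Proof.
(* Beyond this threshold 8dβ - 2H < -4d - 1; since 4d ≤ exp(4d), the factor 4d from path choices and
   sample choice is absorbed and each site costs at most exp(-1). *)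
exists 1 => // beta beta_ge0; exists (8 * d%:R * beta + 4 * d%:R + 1).
  by rewrite ltr_wpDl // addr_ge0 ?mulr_ge0.
move=> H H_gt D L sDL h h_pm1.
have flip_ratio_small : (d * 2)%:R * (2 * flip_ratio d beta H) <= expR (- 1).
  have d4 : (d * 2)%:R * 2 <= expR (4 * d%:R) :> R.
    apply: le_trans (expR_ge1Dx _); rewrite natrM; lra.
  rewrite mulrA (le_trans (ler_wpM2r (expR_ge0 _) d4)) // -expRD ler_expR.
  have : 0 <= 8 * d%:R * beta by rewrite !mulr_ge0.
  by have := ler0n R d; move: H_gt; lra.
apply: ge_sup; first by eexists; exists ([ffun=> true], [ffun=> true]).
move=> _ [[eta eta'] _ <-] /=; apply: ge_sup; first by eexists; exists finset.set0.
move=> _ [A _ <-]; pose DL := [set u : L | val u \in D]%SET.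
have A_loc (s s' : config L) : {in DL, s =1 s'} ->
    (s \in [set s | restr sDL s \in A]%SET) = (s' \in [set s | restr sDL s \in A]%SET).
  move=> ss'; rewrite !inE (_ : restr sDL s = restr sDL s') //; apply/ffunP => u.
  by rewrite !ffunE ss' // inE /= fsvalP.
apply: (le_trans (gibbs_sub_le beta H h eta eta' A_loc)).
(* The case [x == y] covers a site of [D] adjacent to the boundary of [L]: the exit point then lies
   outside [L] and no link starts there. *)
pose hit (x y : lattice d) (q : config L * config L) :=
  (x == y) || [exists v : L, (x == val v) && link (disagreement q) v y].
pose m := joint_mass beta H h eta eta'.
have m_ge0 q : 0 <= m q by exact: joint_mass_ge0.
(* Union bound: [bd_cluster_exit] supplies a pair whose term alone dominates. *)
apply: (@le_trans _ _ (\sum_(x <- extbd D) \sum_(y <- extbd L) \sum_(q | hit x y q) m q)).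
  under [leRHS]eq_bigr do rewrite (exchange_big_dep predT) //=.
  rewrite [leRHS]exchange_big big_mkcond; apply: ler_sum => q _ /=.
  have sum_ge0 : 0 <= \sum_(x <- extbd D) \sum_(y <- extbd L | hit x y q) m q.
    by rewrite sumr_ge0 // => x _; rewrite sumr_ge0.
  case: ifPn => // /pred0Pn[u /andP[/= uD uC]].
  have {uD} uD : val u \in D by move: uD; rewrite inE.
  have [x [y [xD xy]]] := bd_cluster_exit sDL uD uC.
  have hxy : hit x (val y) q.
    apply/orP; case: xy => [->|[v -> vy]]; first by left.
    by right; apply/existsP; exists v; rewrite eqxx.
  rewrite (big_rem x) //= (big_rem (val y)) ?valP //= hxy -addrA lerDl.
  by rewrite addr_ge0 ?sumr_ge0 // => x' _; rewrite sumr_ge0.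
rewrite big_seq [leRHS]big_seq; apply: ler_sum => x xD.
rewrite big_seq [leRHS]big_seq; apply: ler_sum => y yL.
have {}yL : y \notin L by move: yL; rewrite in_extbd => /andP[].
rewrite mul1r.
have [<-|xy] := eqVneq x y.
  rewrite subrr.
  have -> : enorm R (0 : lattice d) = 0.
    by rewrite /enorm big1 ?sqrtr0 // => i _; rewrite mxE expr0n.
  rewrite oppr0 expR0.
  (* With no prescribed site this says that the total joint mass is at most 1. *)
  have := disagreement_prob H beta_ge0 h_pm1 eta eta' (r := [::]) isT.
  rewrite expr0; apply: le_trans.
  by rewrite big_mkcond; apply: ler_sum => q _; case: ifP.
have [xL|xL] := boolP (x \in L); last first.
  rewrite big_pred0 ?expR_ge0 // => q; rewrite /hit (negbTE xy) /=.
  by apply/existsP => -[v /andP[/eqP xv _]]; rewrite xv fsvalP in xL.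
apply: le_trans (link_prob eta eta' [` xL]%fset d_ge1 beta_ge0 h_pm1 flip_ratio_small yL).
rewrite big_mkcond [leRHS]big_mkcond; apply: ler_sum => q _ /=.
rewrite /hit (negbTE xy) /=; case: existsP => [[v /andP[/eqP xv vy]]|_]; last by case: ifP.
by rewrite (_ : [` xL]%fset = v) ?vy //; apply: val_inj.
Qed.
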